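(* Let $S$ be a semilattice-ordered semigroup and let $X=\mathcal{P}(S)$ with the hull-kernel topology. The map $\star:X\times X\to X$, $A\star B=AB=\{ab\mid a\in A,b\in B\}$, is spectral if and only if $S$ has finite decomposition property.
   Context: A semilattice-ordered semigroup is a triple $(S,\cdot,\lor)$ with $S$ nonempty, $(S,\cdot)$ a semigroup, $(S,\lor)$ a semilattice (commutative, associative, idempotent), and $x(y\lor z)=xy\lor xz$, $(x\lor y)z=xz\lor yz$ for all $x,y,z\in S$. $\mathcal{P}(S)$ is the power set of $S$. The hull-kernel topology on $\mathcal{P}(S)$ has open subbasis $D(F)=\{A\in\mathcal{P}(S)\mid F\nsubseteq A\}$, $F$ ranging over finite subsets of $S$; with it $\mathcal{P}(S)$ is a spectral space (quasi-compact, $T_0$, sober, with quasi-compact opens closed under finite intersections and forming a basis), and $X\times X$ with the product topology is a spectral space. A map between spectral spaces is spectral if the preimage of every quasi-compact open set is quasi-compact and open. $S$ has finite decomposition property if the set $\mathrm{Dec}(s)=\{(a,b)\in S\times S\mid ab=s\}$ is finite for every $s\in S$. *)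

(* Defs.v *)
From HB Require Import structures.
From mathcomp Require Import all_boot all_order.
From mathcomp Require Import mathcomp_extra boolp classical_sets functions.
From mathcomp Require Import cardinality filter topology.

Set Implicit Arguments.
Unset Strict Implicit.
Unset Printing Implicit Defensive.

Local Open Scope classical_set_scope.

(* The order of the underlying [joinSemilatticeType] is the one determined by
   its join: [x <= y] iff [x `|` y = y]. *)
HB.mixin Record isSemilatticeOrderedSemigroup (d : Order.disp_t) S
    of Semigroup S & Order.JoinSemilattice d S := {
  slo_inhabited : inhabited S;
  mulg_joinr : right_distributive (fun x y : S => (x * y)%g)
                                  (fun x y : S => (x `|` y)%O);
  mulg_joinl : left_distributive (fun x y : S => (x * y)%g)
                                 (fun x y : S => (x `|` y)%O)
}.

#[short(type="sloSemigroupType")]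
HB.structure Definition SemilatticeOrderedSemigroup (d : Order.disp_t) :=
  { S of isSemilatticeOrderedSemigroup d S
       & Semigroup S & Order.JoinSemilattice d S }.

(* [set S] is convertible to [S -> Prop], hence the alias to carry the
   hull-kernel topology. *)
Definition hullkernel (S : Type) : Type := set S.

HB.instance Definition _ (S : Type) := Pointed.copy (hullkernel S) (set S).

Definition hk_subbase {S : Type} (F : set S) : set (hullkernel S) :=
  [set A | ~ (F `<=` A)].

HB.instance Definition _ (S : Type) :=
  @isSubBaseTopological.Build (hullkernel S) (set S) finite_set hk_subbase.

(* [compact] has no separation requirement: it is quasi-compactness. *)
Definition spectral_map {X Y : topologicalType} (f : X -> Y) : Prop :=
  forall U : set Y, open U -> compact U ->
    open (f @^-1` U) /\ compact (f @^-1` U).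

Definition Dec {S : semigroupType} (s : S) : set (S * S) :=
  [set p | (p.1 * p.2)%g = s].

Definition finite_decomposition_property (S : semigroupType) : Prop :=
  forall s : S, finite_set (Dec s).

Definition set_mul {S : semigroupType} (AB : hullkernel S * hullkernel S) :
    hullkernel S :=
  [set (a * b)%g | a in (AB.1 : set S) & b in (AB.2 : set S)].

(* Main.v *)
From HB Require Import structures.
Require Import Defs.
From mathcomp Require Import all_boot all_order.
From mathcomp Require Import finmap.
From mathcomp Require Import mathcomp_extra boolp classical_sets functions.
From mathcomp Require Import cardinality filter topology.

Set Implicit Arguments.
Unset Strict Implicit.
Unset Printing Implicit Defensive.

Local Open Scope classical_set_scope.

(** The compact open subsets of a power set with the hull-kernel topology have
    a combinatorial description: they are the down-closed families of sets in
    which membership depends on finitely many points only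
    ([supported_open_compact], [open_compact_supported]).  The product of two
    power sets of [S] is again a power set, that of [S + S], with the
    hull-kernel topology ([pair_coordinates]), so the same description applies
    to the source and to the target of the multiplication of sets.  Both
    implications then become statements about finite supports.

    If every element has finitely many decompositions and [U] is supported by
    the finite set [H], then whether [AB] belongs to [U] depends on the trace of
    [AB] on [H], hence only on the points of [A] and [B] that occur in a
    decomposition of an element of [H]; there are finitely many of these, so the
    preimage of [U] is finitely supported ([support_preimage_set_mul]).

    Conversely, for a point [s], the family of all sets that omit [s] is compact
    open, so the family of all pairs [(A, B)] with [s] outside [AB] has a finite
    support if multiplication is spectral.  When [ab = s], the pair of
    singletons [{a}], [{b}] is outside this family, but it enters it as soon as
    [a] or [b] is removed.  So [a] and [b] both lie in the support
    ([Dec_sub_support]), which leaves finitely many choices for [(a, b)]. *)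

HB.instance Definition _ (T U : ptopologicalType) :=
  Pointed.on (T * U)%type.

(** [e] presents [T] as the power set of [J] with the hull-kernel topology.  The
    basic neighbourhood of [t] given by a finite [F] consists of the points
    whose sets contain no element of [F] outside [e t]; it is the intersection
    of the subbasic sets of the singletons [[set j]] with [j] in [F] and not in
    [e t]. *)
Definition hull_coordinates (T : topologicalType) (J : choiceType)
    (e : T -> set J) : Prop :=
  (forall P, exists t, e t = P) /\
  (forall t W, nbhs t W <->
    exists2 F, finite_set F & [set u | e u `&` F `<=` e t] `<=` W).

(** This expresses at once that [K] is down-closed along [e] (take [e u] inside
    [e t]) and that membership of [t] in [K] depends only on [e t `&` F]. *)
Definition supported_by (T : Type) (J : choiceType) (e : T -> set J)
    (F : set J) (K : set T) : Prop :=
  forall t u, K t -> e u `&` F `<=` e t -> K u.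

Section CompactOpen.
Variables (T : ptopologicalType) (J : choiceType) (e : T -> set J).
Hypothesis e_coord : hull_coordinates e.

(** When [e t] contains the complement of [F], the cone of [t] is the set of all
    points below [t].  Open sets are down-closed, so every neighbourhood of [t]
    contains the cone, and every filter on the cone clusters at [t]. *)
Lemma compact_cone (F : set J) (t : T) : ~` F `<=` e t ->
  compact [set u | e u `&` F `<=` e t].
Proof.
move=> FCt Filt PF FU; exists t; split; first by move=> j [].
move=> A B FA /e_coord.2[G _ GB].
have [u [Au ut]] := filter_ex (filterI FA FU).
exists u; split=> //; apply: GB => j [uj _].
by have [Fj|/FCt//] := pselect (F j); exact: ut.
Qed.

(** [K] is the union of the cones of those of its members that are maximal for
    a given trace [P] on [F], namely the sets [P `|` ~` F].  Since [F] has
    finitely many subsets, the union is finite. *)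
Lemma supported_open_compact (F : set J) (K : set T) :
  finite_set F -> supported_by e F K -> open K /\ compact K.
Proof.
move=> finF KF; split.
  by rewrite openE => t Kt; apply/e_coord.2; exists F => // u /(KF _ _ Kt).
have /choice[top topE] (P : set J) := e_coord.1 (P `|` ~` F).
have -> : K = \big[setU/set0]_(P <- fpowerset (fset_set F)
    | `[< K (top [set` P]) >]) [set u | e u `&` F `<=` e (top [set` P])].
  rewrite -bigcup_seq_cond; apply/seteqP; split=> t.
    move=> Kt; pose P := fset_set (e t `&` F).
    have PE : [set` P] = e t `&` F.
      by rewrite fset_setK //; exact: finite_setIr.
    exists P; rewrite /= ?PE ?topE; last by move=> j; left.
    apply/andP; split.
      by rewrite fpowersetE -fset_set_sub //; exact: finite_setIr.
    apply/asboolP; apply: KF Kt _; rewrite topE => j [[[]//|] + Fj].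
    by move=> /(_ Fj).
  by move=> [P /= /andP[_ /asboolP KP] tP]; exact: KF KP tP.
apply: bigsetU_compact => P _; apply: compact_cone.
by rewrite topE => j; right.
Qed.

(** Around each of its points, [K] contains a cone cut out by a finite set; by
    compactness finitely many of these cones cover [K], and the union of their
    finite sets supports [K]. *)
Lemma open_compact_supported (K : set T) :
  open K -> compact K -> exists2 F, finite_set F & supported_by e F K.
Proof.
move=> oK; rewrite compact_cover => cK.
have /choice[G GP] t : exists F : set J, finite_set F /\
    (K t -> [set u | e u `&` F `<=` e t] `<=` K).
  have [Kt|nKt] := pselect (K t); last by exists set0; split.
  have /e_coord.2[F finF FK] : nbhs t K by exact: open_nbhs_nbhs.
  by exists F.
pose cone t := [set u | e u `&` G t `<=` e t].
have [|t Kt|D DK KD] := cK T K (fun t => interior (cone t)).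
- by move=> t _; exact: open_interior.
- exists t => //; apply/e_coord.2; exists (G t) => //; exact: (GP t).1.
exists (\bigcup_(t in [set` D]) G t).
  by apply: bigcup_finite => // t _; exact: (GP t).1.
move=> t u /KD[v Dv /interior_subset vt] ut.
have Kv : K v by exact/set_mem/DK.
apply: (GP v).2 => // j [uj Gj]; apply: vt; split=> //; apply: ut; split=> //.
by exists v.
Qed.

End CompactOpen.

Section Coordinates.
Variable S : choiceType.

Lemma hullkernel_openE (U : set (hullkernel S)) : open U =
  exists2 D, D `<=` finI_from finite_set (@hk_subbase S) & \bigcup_(B in D) B = U.
Proof. by []. Qed.

Lemma hullkernel_coordinates :
  hull_coordinates (id : hullkernel S -> set S).
Proof.
split=> [P|A W]; first by exists P.
split.
  rewrite nbhsE => -[U [+ UA] UW]; rewrite hullkernel_openE => -[D Dfin DU].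
  move: UA; rewrite -DU => -[B DB BA].
  have [E Efin BE] := Dfin _ DB.
  (* [B] is a finite intersection of sets [hk_subbase F]; a set whose trace on
     all these [F] lies in [A] contains none of them, because [A] does not. *)
  exists (\bigcup_(F in [set` E]) F).
    by apply: bigcup_finite => // F /Efin/set_mem.
  move=> A' A'A; apply: UW; rewrite -DU; exists B => //.
  rewrite -BE => F EF FA'.
  move: BA; rewrite -BE => /(_ F EF); apply => s Fs.
  by apply: A'A; split; [exact: FA'|exists F].
move=> [F finF FW]; apply: filterS FW _.
have -> : [set A' : hullkernel S | A' `&` F `<=` A] =
    \bigcap_(s in [set` fset_set F]) [set A' : hullkernel S | A' s -> A s].
  rewrite fset_setK //; apply/seteqP; split=> A' /=.
    by move=> h s Fs A's; apply: h.
  by move=> h s [A's Fs]; apply: h.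
apply: filter_bigI => s _.
have [As|nAs] := pselect (A s); first by apply: filterE => A' _.
apply: filterS (_ : nbhs A (hk_subbase [set s])).
  by move=> A' /= sA' A's; exfalso; apply: sA' => _ ->.
apply: open_nbhs_nbhs; split; last by move=> sA; exact/nAs/sA.
rewrite hullkernel_openE; exists [set hk_subbase [set s]]; last by rewrite bigcup_set1.
move=> _ ->; exact: finI_from1 (finite_set1 s).
Qed.

(** The disjoint union of the two components of a pair. *)
Definition pair_coord (p : hullkernel S * hullkernel S) : set (S + S) :=
  [set j | match j with inl a => (p.1 : set S) a | inr b => (p.2 : set S) b end].

Lemma pair_coordinates : hull_coordinates pair_coord.
Proof.
split=> [P|[A B] W].
  exists (inl @^-1` P, inr @^-1` P).
  by apply/seteqP; split=> -[].
split.
  move=> [[U V] /= [/hullkernel_coordinates.2[F finF FU]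
                    /hullkernel_coordinates.2[G finG GV]] UVW].
  exists (inl @` F `|` inr @` G).
    by rewrite finite_setU; split; exact: finite_image.
  move=> [A' B'] /= AB'; apply: UVW; split=> /=.
    by apply: FU => a [A'a Fa]; apply: (AB' (inl a)); split=> //; left; exists a.
  by apply: GV => b [B'b Gb]; apply: (AB' (inr b)); split=> //; right; exists b.
move=> [F finF FW].
exists ([set A' : hullkernel S | (A' : set S) `&` inl @^-1` F `<=` A],
        [set B' : hullkernel S | (B' : set S) `&` inr @^-1` F `<=` B]).
  split=> /=; apply/hullkernel_coordinates.2.
    by exists (inl @^-1` F) => //; apply: finite_preimage => // ? ? _ _ [].
  by exists (inr @^-1` F) => //; apply: finite_preimage => // ? ? _ _ [].
move=> [A' B'] [/= AA' BB']; apply: FW => -[a|b] [] /= ? ?.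
  exact: AA'.
exact: BB'.
Qed.

End Coordinates.

Lemma support_preimage_set_mul (S : semigroupType) (H : set S)
    (U : set (hullkernel S)) :
  let D := \bigcup_(s in H) Dec s in
  supported_by id H U ->
  supported_by (@pair_coord S) (inl @` (fst @` D) `|` inr @` (snd @` D))
    (@set_mul S @^-1` U).
Proof.
move=> D UH [A B] [A' B'] /= UAB AB'; apply: UH UAB _.
move=> _ [[a A'a [b B'b <-]] Hab].
have Dab : D (a, b) by exists (a * b)%g.
exists a.
  by apply: (AB' (inl a)); split=> //; left; exists a => //; exists (a, b).
exists b => //.
by apply: (AB' (inr b)); split=> //; right; exists b => //; exists (a, b).
Qed.

Lemma Dec_sub_support (S : semigroupType) (s : S) (F : set (S + S)) :
  supported_by (@pair_coord S) F (@set_mul S @^-1` [set A | ~ A s]) ->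
  Dec s `<=` (inl @^-1` F) `*` (inr @^-1` F).
Proof.
move=> KF [a b] /= abs; rewrite /Dec/= in abs.
have abK : ~ ~ set_mul (([set a] : hullkernel S), ([set b] : hullkernel S)) s.
  by apply; exists a => //; exists b.
split=> /=; apply: contrapT => nF; apply: abK.
  (* If [inl a] is outside [F], then [F] does not distinguish the pair of
     singletons from [(set0, [set b])], whose product is empty. *)
  apply: (KF (set0, [set b])) => [[? []]|[a'|b'] []//= ->].
  by move=> /nF.
apply: (KF ([set a], set0)) => [[? _ [? []]]|[a'|b'] []//= ->].
by move=> /nF.
Qed.

(** This is the compact open family of sets to which spectrality is applied. *)
Lemma omit_point_supported (S : choiceType) (s : S) :
  supported_by (id : hullkernel S -> set S) [set s] [set A | ~ A s].
Proof. by move=> A A' nAs AA' A's; exact/nAs/AA'. Qed.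

Theorem theorem4p17 (d : Order.disp_t) (S : sloSemigroupType d) :
  spectral_map (@set_mul S) <-> finite_decomposition_property S.
Proof.
split=> [spec s|fdp U oU cU].
  have [oU cU] := supported_open_compact (hullkernel_coordinates S)
    (finite_set1 s) (omit_point_supported (s := s)).
  have [oK cK] := spec _ oU cU.
  have [F finF KF] := open_compact_supported (pair_coordinates S) oK cK.
  apply: sub_finite_set (Dec_sub_support KF) _; apply: finite_setX.
    by apply: finite_preimage => // ? ? _ _ [].
  by apply: finite_preimage => // ? ? _ _ [].
have [H finH UH] := open_compact_supported (hullkernel_coordinates S) oU cU.
apply: (supported_open_compact (pair_coordinates S) _ (support_preimage_set_mul UH)).
have finD : finite_set (\bigcup_(s in H) Dec s) by exact: bigcup_finite.
by rewrite finite_setU; split; do 2!apply: finite_image.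
Qed.
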